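(* Let $\mathbb{K}$ be a field of characteristic zero, $\mathcal{K}$ a non-empty set of finite groups, and $\ell : \mathbb{N}-\{0\} \to \mathbb{K}^\times$ a monoid homomorphism (from the multiplicative monoid of positive integers). If $\ell$ is algebraically independent with respect to $\mathcal{K}$, then the algebra $\Lambda$ is locally semisimple.
   Context: Algebraic independence: $\ell$ is called algebraically independent with respect to $\mathcal{K}$ when, letting $q$ run over the prime divisors of the orders of the groups in $\mathcal{K}$, the elements $\ell(q)$ are algebraically independent over the minimal subfield $\mathbb{Q}$ of $\mathbb{K}$. Subgroups of direct products: for groups $F,G$, elements of $F\times G$ are written $f\times g$, and $\mathcal{S}(F,G)$ is the set of subgroups of $F\times G$. For $U\in\mathcal{S}(F,G)$, put $U_\bullet=\{g\in G: 1\times g\in U\}$ and ${}_\bullet U=\{f\in F: f\times 1\in U\}$. For $U\in\mathcal{S}(F,G)$, $V\in\mathcal{S}(G,H)$, the star product $U*V\in\mathcal{S}(F,H)$ is the subgroup of those $f\times h$ for which there exists $g\in G$ with $f\times g\in U$ and $g\times h\in V$. Put $\sigma(U,V)=\ell(|U_\bullet\cap{}_\bullet V|)$. The algebra $\Lambda=\Lambda_{\mathcal{K}}$ over $\mathbb{K}$ (associative, not necessarily unital) has $\mathbb{K}$-basis consisting of formal symbols $s_U^{F,G}$ with $F,G\in\mathcal{K}$ and $U\in\mathcal{S}(F,G)$, with multiplication $s_U^{F,G}s_V^{G,H}=\sigma(U,V)\,s_{U*V}^{F,H}$, and $s_U^{F,G}s_V^{G',H}=0$ when $G\neq G'$. A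 ring $A$ (not necessarily unital) is locally unital if every finite subset of $A$ is contained in $eAe$ for some idempotent $e$ of $A$. It is locally semisimple if it is locally unital and the unital ring $eAe$ is semisimple for every idempotent $e$ of $A$. *)

(* Defs.v *)
From HB Require Import structures.
From mathcomp Require Import all_boot all_order all_algebra all_fingroup.
From mathcomp Require Import finmap.
From mathcomp Require Import monalg.

Set Implicit Arguments.
Unset Strict Implicit.
Unset Printing Implicit Defensive.

Import GRing.Theory.
Local Open Scope ring_scope.

(* Rings that need not have a unit; MathComp only has unital ones. *)

HB.mixin Record Zmodule_isRng A of GRing.Zmodule A := {
  rmul : A -> A -> A;
  rmulA : associative rmul;
  rmulDl : left_distributive rmul +%R;
  rmulDr : right_distributive rmul +%R
}.

#[short(type="rngType")]
HB.structure Definition Rng := {A of Zmodule_isRng A & GRing.Zmodule A}.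

Declare Scope rng_scope.
Delimit Scope rng_scope with rng.
Notation "x ** y" := (rmul x y) (at level 40, left associativity) : rng_scope.
Local Open Scope rng_scope.

Section RngTheory.
Variable A : rngType.
Implicit Types x y z : A.

Lemma rmul0l x : 0 ** x = 0.
Proof. by apply: (addrI (0 ** x)); rewrite -rmulDl !addr0. Qed.

Lemma rmul0r x : x ** 0 = 0.
Proof. by apply: (addrI (x ** 0)); rewrite -rmulDr !addr0. Qed.

Lemma rmulNl x y : (- x) ** y = - (x ** y).
Proof. by apply: (addrI (x ** y)); rewrite -rmulDl !subrr rmul0l. Qed.

Lemma rmulNr x y : x ** (- y) = - (x ** y).
Proof. by apply: (addrI (x ** y)); rewrite -rmulDr !subrr rmul0r. Qed.

Record idempotent := Idempotent { idem_val :> A; idemP : idem_val ** idem_val = idem_val }.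

End RngTheory.

Section Corner.
Variables (A : rngType) (e : idempotent A).

(* For an idempotent e this is the set of all e a e, see [cornerP]. *)
Definition corner_pred : pred A := fun x => e ** x ** e == x.

Lemma cornerP x : reflect (exists a, x = e ** a ** e) (corner_pred x).
Proof.
apply: (iffP eqP) => [<-|[a ->]]; first by exists x.
by rewrite -!rmulA idemP !rmulA idemP.
Qed.

Lemma corner_zmod_closed : zmod_closed corner_pred.
Proof.
split=> [|x y]; rewrite !unfold_in.
  by rewrite rmul0r rmul0l.
by move=> /eqP ex /eqP ey; rewrite rmulDr rmulDl rmulNr rmulNl ex ey.
Qed.
HB.instance Definition _ :=
  GRing.isZmodClosed.Build A corner_pred corner_zmod_closed.

Record corner := Corner { corner_val : A; _ : corner_val \in corner_pred }.
HB.instance Definition _ := [isSub for corner_val].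
HB.instance Definition _ := [Choice of corner by <:].
HB.instance Definition _ := [SubChoice_isSubZmodule of corner by <:].

Lemma corner_idl (x : corner) : e ** val x = val x.
Proof.
by have /cornerP[a ->] := valP x; rewrite !rmulA idemP.
Qed.

Lemma corner_idr (x : corner) : val x ** e = val x.
Proof.
by have /cornerP[a ->] := valP x; rewrite -!rmulA idemP.
Qed.

Fact corner_one_subproof : (e : A) \in corner_pred.
Proof. by apply/eqP; rewrite !idemP. Qed.

Fact corner_mul_subproof (x y : corner) : val x ** val y \in corner_pred.
Proof. by apply/eqP; rewrite rmulA corner_idl -rmulA corner_idr. Qed.

Definition corner_one := Corner corner_one_subproof.
Definition corner_mul x y := Corner (corner_mul_subproof x y).

Fact corner_mulA : associative corner_mul.
Proof. by move=> x y z; apply: val_inj; rewrite /= rmulA. Qed.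
Fact corner_mul1l : left_id corner_one corner_mul.
Proof. by move=> x; apply: val_inj; rewrite /= corner_idl. Qed.
Fact corner_mul1r : right_id corner_one corner_mul.
Proof. by move=> x; apply: val_inj; rewrite /= corner_idr. Qed.
Fact corner_mulDl : left_distributive corner_mul +%R.
Proof. by move=> x y z; apply: val_inj; rewrite /= rmulDl. Qed.
Fact corner_mulDr : right_distributive corner_mul +%R.
Proof. by move=> x y z; apply: val_inj; rewrite /= rmulDr. Qed.

HB.instance Definition _ := GRing.Zmodule_isPzRing.Build corner
  corner_mulA corner_mul1l corner_mul1r corner_mulDl corner_mulDr.

End Corner.

(* A module is semisimple when it is the (possibly infinite) direct sum of a
   family of simple submodules. *)
Section Semisimple.
Variables (R : pzRingType) (M : lmodType R).

Definition is_submodule (N : M -> Prop) : Prop :=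
  N 0 /\ forall (a : R) x y, N x -> N y -> N (a *: x + y).

Definition simple_submodule (N : M -> Prop) : Prop :=
  [/\ is_submodule N,
      exists2 x, N x & x != 0
    & forall N', is_submodule N' -> (forall x, N' x -> N x) ->
        (forall x, N' x -> x = 0) \/ (forall x, N x -> N' x)].

Definition is_direct_sum (J : Type) (N : J -> M -> Prop) : Prop :=
  (forall x, exists n (j : 'I_n -> J) (y : 'I_n -> M),
     (forall i, N (j i) (y i)) /\ x = \sum_i y i) /\
  (forall n (j : 'I_n -> J) (y : 'I_n -> M),
     injective j -> (forall i, N (j i) (y i)) -> \sum_i y i = 0 ->
     forall i, y i = 0).

Definition semisimple_module : Prop :=
  exists (J : Type) (N : J -> M -> Prop),
    (forall j, simple_submodule (N j)) /\ is_direct_sum N.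

End Semisimple.

Definition semisimple_ring (R : pzRingType) : Prop := semisimple_module R^o.

Definition locally_unital (A : rngType) : Prop :=
  forall s : seq A, exists e : idempotent A, {subset s <= corner_pred e}.

Definition locally_semisimple (A : rngType) : Prop :=
  locally_unital A /\ forall e : idempotent A, semisimple_ring (corner e).

Section BilinearExtension.
Variables (K : fieldType) (B : choiceType) (m : B -> B -> {malg K[B]}).
Implicit Types x y z : {malg K[B]}.

Definition bilin x y : {malg K[B]} :=
  \sum_(a <- msupp x) \sum_(b <- msupp y) (x@_a * y@_b) *: m a b.

Lemma bilinEw (d d' : {fset B}) x y :
    (msupp x `<=` d)%fset -> (msupp y `<=` d')%fset ->
  bilin x y = \sum_(a <- d) \sum_(b <- d') (x@_a * y@_b) *: m a b.
Proof.
move=> sxd syd; rewrite /bilin (big_fset_incl _ sxd) /=; last first.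
  move=> a _ /mcoeff_outdom->; rewrite big1 // => b _.
  by rewrite mul0r scale0r.
apply: eq_bigr => a _; rewrite (big_fset_incl _ syd) //=.
by move=> b _ /mcoeff_outdom->; rewrite mulr0 scale0r.
Qed.

Lemma bilinDl : left_distributive bilin +%R.
Proof.
move=> x y z.
pose d := (msupp x `|` msupp y)%fset.
rewrite (@bilinEw d (msupp z) (x + y)) ?msuppD_le //.
rewrite (@bilinEw d (msupp z) x) ?fsubsetUl //.
rewrite (@bilinEw d (msupp z) y) ?fsubsetUr //.
rewrite -big_split /=; apply: eq_bigr => a _.
rewrite -big_split /=; apply: eq_bigr => b _.
by rewrite mcoeffD mulrDl scalerDl.
Qed.

Lemma bilinDr : right_distributive bilin +%R.
Proof.
move=> z x y.
pose d := (msupp x `|` msupp y)%fset.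
rewrite (@bilinEw (msupp z) d z (x + y)) ?msuppD_le //.
rewrite (@bilinEw (msupp z) d z x) ?fsubsetUl //.
rewrite (@bilinEw (msupp z) d z y) ?fsubsetUr //.
rewrite -big_split /=; apply: eq_bigr => a _.
rewrite -big_split /=; apply: eq_bigr => b _.
by rewrite mcoeffD mulrDr scalerDl.
Qed.

Lemma bilinZl c x y : bilin (c *: x) y = c *: bilin x y.
Proof.
rewrite (@bilinEw (msupp x) (msupp y) (c *: x)) ?msuppZ_le //.
rewrite /bilin scaler_sumr; apply: eq_bigr => a _.
rewrite scaler_sumr; apply: eq_bigr => b _.
by rewrite mcoeffZ scalerA mulrA.
Qed.

Lemma bilinZr c x y : bilin x (c *: y) = c *: bilin x y.
Proof.
rewrite (@bilinEw (msupp x) (msupp y) x (c *: y)) ?msuppZ_le //.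
rewrite /bilin scaler_sumr; apply: eq_bigr => a _.
rewrite scaler_sumr; apply: eq_bigr => b _.
by rewrite mcoeffZ scalerA mulrCA.
Qed.

Lemma bilinUU a b : bilin << a >> << b >> = m a b.
Proof.
by rewrite /bilin !msuppU oner_eq0 !big_seq_fset1 !mcoeffUU mulr1 scale1r.
Qed.

Lemma bilin0l x : bilin 0 x = 0.
Proof. by rewrite -[X in bilin X _](scale0r 0) bilinZl scale0r. Qed.

Lemma bilin0r x : bilin x 0 = 0.
Proof. by rewrite -[X in bilin _ X](scale0r 0) bilinZr scale0r. Qed.

Lemma malg_basisE x : x = \sum_(a <- msupp x) x@_a *: << a >>.
Proof.
rewrite [LHS]monalgE; apply: eq_bigr => a _; apply/malgP => b.
by rewrite mcoeffZ !mcoeffU mulrnAr mulr1.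
Qed.

Lemma malg_ind (P : {malg K[B]} -> Prop) :
    P 0 -> (forall x y, P x -> P y -> P (x + y)) ->
    (forall c x, P x -> P (c *: x)) -> (forall a, P << a >>) ->
  forall x, P x.
Proof.
move=> P0 PD PZ PU x; rewrite [x]malg_basisE.
by apply: (big_ind P) => // a _; apply: PZ.
Qed.

Lemma bilinA :
    (forall a b c, bilin << a >> (m b c) = bilin (m a b) << c >>) ->
  associative bilin.
Proof.
move=> mA; apply: malg_ind => [|x x' IHx IHx'|c x IHx|a] y z.
- by rewrite !bilin0l.
- by rewrite !bilinDl IHx IHx'.
- by rewrite !bilinZl IHx.
move: y z; apply: malg_ind => [|y y' IHy IHy'|c y IHy|b] z.
- by rewrite bilin0l !bilin0r bilin0l.
- by rewrite bilinDl !bilinDr bilinDl IHy IHy'.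
- by rewrite bilinZl !bilinZr bilinZl IHy.
move: z; apply: malg_ind => [|z z' IHz IHz'|c z IHz|c].
- by rewrite !bilin0r.
- by rewrite !bilinDr IHz IHz'.
- by rewrite !bilinZr IHz.
by rewrite !bilinUU mA.
Qed.

End BilinearExtension.

Section StarProduct.
Local Open Scope group_scope.

Definition rbullet (F G : finGroupType) (U : {set F * G}) : {set G} :=
  [set g | (1, g) \in U].

Definition lbullet (F G : finGroupType) (U : {set F * G}) : {set F} :=
  [set f | (f, 1) \in U].

Definition star_set (F G H : finGroupType) (U : {set F * G}) (V : {set G * H})
    : {set F * H} :=
  [set x | [exists g, ((x.1, g) \in U) && ((g, x.2) \in V)]].

Lemma star_setP (F G H : finGroupType) (U : {set F * G}) (V : {set G * H}) f h :
  reflect (exists g, (f, g) \in U /\ (g, h) \in V) ((f, h) \in star_set U V).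
Proof.
rewrite inE /=; apply: (iffP existsP) => -[g].
  by case/andP; exists g.
by case=> Ug Vg; exists g; rewrite Ug.
Qed.

Lemma pairM (F G : finGroupType) (f f' : F) (g g' : G) :
  ((f, g) : F * G) * (f', g') = (f * f', g * g').
Proof. by []. Qed.

Lemma star_group_set (F G H : finGroupType)
    (U : {group F * G}) (V : {group G * H}) : group_set (star_set U V).
Proof.
apply/group_setP; split.
  by apply/star_setP; exists 1; split; apply: group1.
move=> [f h] [f' h'] /star_setP[g [Ug Vg]] /star_setP[g' [Ug' Vg']].
by apply/star_setP; exists (g * g'); rewrite -!pairM !groupM.
Qed.

Definition star (F G H : finGroupType) (U : {group F * G}) (V : {group G * H})
  : {group F * H} := Group (star_group_set U V).

Lemma starA (F G H L : finGroupType)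
    (U : {group F * G}) (V : {group G * H}) (W : {group H * L}) :
  star U (star V W) = star (star U V) W.
Proof.
apply/val_inj/setP => -[f l] /=; apply/star_setP/star_setP.
  by case=> g [Ug /star_setP[h [Vh Wh]]]; exists h; split=> //;
     apply/star_setP; exists g.
by case=> h [/star_setP[g [Ug Vg]] Wh]; exists g; split=> //;
   apply/star_setP; exists h.
Qed.

Definition meet_order (F G H : finGroupType)
    (U : {group F * G}) (V : {group G * H}) : nat :=
  #|rbullet U :&: lbullet V|.

Lemma meet_order_gt0 (F G H : finGroupType)
    (U : {group F * G}) (V : {group G * H}) : (0 < meet_order U V)%N.
Proof. by apply/card_gt0P; exists 1; rewrite !inE !group1. Qed.

Lemma meet_order_cocycle (F G H L : finGroupType)
    (U : {group F * G}) (V : {group G * H}) (W : {group H * L}) :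
  (meet_order V W * meet_order U (star V W) =
   meet_order U V * meet_order (star U V) W)%N.
Proof.
pose X := [set x : G * H | [&& (1, x.1) \in U, x \in V & (x.2, 1) \in W]].
have gX : group_set X.
  apply/group_setP; split; first by rewrite inE !group1.
  move=> [g h] [g' h']; rewrite !inE /= => /and3P[Ug Vg Wg] /and3P[Ug' Vg' Wg'].
  rewrite -[1]mulg1 -[X in [&& _, _ & (_, X) \in _]]mulg1 -!pairM.
  by rewrite !groupM.
pose XG := Group gX.
have cardX (T : finGroupType) (p : {morphism [set: G * H] >-> T}) :
    (#|p @* X| * #|'ker_X p| = #|X|)%N.
  have := card_morphim p XG; rewrite setTI => ->.
  by rewrite mulnC -(LagrangeI XG ('ker p)).
have imf : fst @* X = rbullet U :&: lbullet (star V W) :> {set G}.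
  apply/setP => g; rewrite !inE /=; apply/morphimP/andP.
    case=> -[g' h] _; rewrite inE /= => /and3P[Ug Vg Wg] ->; split=> //.
    by apply/existsP; exists h; rewrite Vg.
  case=> Ug /existsP[h /andP[Vg Wg]].
  by exists (g, h); rewrite ?inE //= Ug Vg.
have ims : snd @* X = rbullet (star U V) :&: lbullet W :> {set H}.
  apply/setP => h; rewrite !inE /=; apply/morphimP/andP.
    case=> -[g h'] _; rewrite inE /= => /and3P[Ug Vg Wg] ->; split=> //.
    by apply/existsP; exists g; rewrite Ug.
  case=> /existsP[g /andP[Ug Vg]] Wg.
  by exists (g, h); rewrite ?inE //= Ug Vg.
have kerf : 'ker_X (@fst G H) = pair 1 @: (rbullet V :&: lbullet W).
  apply/setP => -[g h]; apply/setIP/imsetP.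
    case; rewrite inE /= => /and3P[_ Vg Wg] /kerP/= g1; have {}g1 := g1 (in_setT _).
    by exists h; rewrite ?g1 // !inE -[X in (X, h) \in _]g1 Vg.
  case=> h' Xh [-> ->]; move: Xh; rewrite !inE /= => /andP[Vh Wh].
  by rewrite group1 Vh Wh eqxx.
have kers : 'ker_X (@snd G H) = (fun g => (g, 1)) @: (rbullet U :&: lbullet V).
  apply/setP => -[g h]; apply/setIP/imsetP.
    case; rewrite inE /= => /and3P[Ug Vg _] /kerP/= h1; have {}h1 := h1 (in_setT _).
    by exists g; rewrite ?h1 // !inE -[X in (g, X) \in V]h1 Vg Ug.
  case=> g' Xg [-> ->]; move: Xg; rewrite !inE /= => /andP[Ug Vg].
  by rewrite group1 Ug Vg eqxx.
have := cardX _ (fst_morphism G H); rewrite imf kerf card_imset => [|h h' []//].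
have := cardX _ (snd_morphism G H); rewrite ims kers card_imset => [|g g' []//].
by rewrite /meet_order mulnC => -> <-; rewrite mulnC.
Qed.

End StarProduct.

(* Monoid homomorphisms from the positive integers under multiplication to the
   units of K; the value at 0 is irrelevant. *)
Record posnat_hom (K : fieldType) := PosnatHom {
  posnat_fun :> nat -> K;
  posnat_fun1 : posnat_fun 1 = 1;
  posnat_funM : forall m n, (0 < m)%N -> (0 < n)%N ->
    posnat_fun (m * n)%N = posnat_fun m * posnat_fun n;
  posnat_fun_neq0 : forall n, (0 < n)%N -> posnat_fun n != 0
}.

(* A set of finite groups is a family [gT] indexed by [I]; isomorphic groups
   with different indices count as different elements of the set. *)
Section SubgroupAlgebra.
Variables (K : fieldType) (I : choiceType) (gT : I -> finGroupType).
Variable ell : posnat_hom K.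

Definition sigma (F G H : finGroupType)
    (U : {group F * G}) (V : {group G * H}) : K :=
  ell (meet_order U V).

Lemma sigma_cocycle (F G H L : finGroupType)
    (U : {group F * G}) (V : {group G * H}) (W : {group H * L}) :
  sigma V W * sigma U (star V W) = sigma U V * sigma (star U V) W.
Proof.
rewrite /sigma -(posnat_funM ell (meet_order_gt0 V W)) ?meet_order_gt0 //.
by rewrite meet_order_cocycle posnat_funM ?meet_order_gt0.
Qed.

Definition subgroup_index : Type :=
  {FG : I * I & {group gT FG.1 * gT FG.2}}.
HB.instance Definition _ := Choice.on subgroup_index.

Definition sindex F G (U : {group gT F * gT G}) : subgroup_index :=
  existT (fun FG : I * I => {group gT FG.1 * gT FG.2}) (F, G) U.

(* s_U^{F,G} s_V^{G',H}; see [sbasis_mul] and [sbasis_mul_neq]. *)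
Definition basis_mul (a b : subgroup_index) : {malg K[subgroup_index]} :=
  let: existT (F, G) U := a in
  let: existT (G', H) V := b in
  if G =P G' is ReflectT eqG then
    let U' := ecast G {group gT F * gT G} eqG U in
    sigma U' V *: << sindex (star U' V) >>
  else 0.

Lemma basis_mulE F G H (U : {group gT F * gT G}) (V : {group gT G * gT H}) :
  basis_mul (sindex U) (sindex V) = sigma U V *: << sindex (star U V) >>.
Proof.
by rewrite /basis_mul /=; case: eqP => [eqG|[]]; first rewrite (eq_axiomK eqG).
Qed.

Lemma basis_mul_neq F G G' H
    (U : {group gT F * gT G}) (V : {group gT G' * gT H}) :
  G != G' -> basis_mul (sindex U) (sindex V) = 0.
Proof. by rewrite /basis_mul /=; case: eqP. Qed.

Lemma basis_mulA a b c :
  bilin basis_mul << a >> (basis_mul b c) =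
  bilin basis_mul (basis_mul a b) << c >>.
Proof.
case: a b c => [[F G] U] [[G' H] V] [[H' L] W].
rewrite -/(sindex U) -/(sindex V) -/(sindex W).
have [eqG|neG] := eqVneq G G'; have [eqH|neH] := eqVneq H H'.
- subst G' H'; rewrite (basis_mulE U V) (basis_mulE V W) bilinZr bilinZl.
  rewrite [X in _ *: X = _]bilinUU [X in _ = _ *: X]bilinUU.
  rewrite (basis_mulE U (star V W)) (basis_mulE (star U V) W) !scalerA.
  by rewrite sigma_cocycle starA.
- subst G'; rewrite (basis_mul_neq V W neH) (basis_mulE U V) bilin0r bilinZl.
  rewrite (bilinUU _ (sindex (star U V)) (sindex W)).
  by rewrite (basis_mul_neq (star U V) W neH) scaler0.
- subst H'; rewrite (basis_mul_neq U V neG) (basis_mulE V W) bilin0l bilinZr.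
  rewrite (bilinUU _ (sindex U) (sindex (star V W))).
  by rewrite (basis_mul_neq U (star V W) neG) scaler0.
by rewrite (basis_mul_neq U V neG) (basis_mul_neq V W neH) bilin0l bilin0r.
Qed.

(* The type mentions ell because its multiplication depends on ell. *)
Definition subgroup_algebra (_ : posnat_hom K) : Type :=
  {malg K[subgroup_index]}.
Local Notation Lambda := (subgroup_algebra ell).
HB.instance Definition _ := GRing.Lmodule.on Lambda.

HB.instance Definition _ := Zmodule_isRng.Build Lambda
  (bilinA basis_mulA) (@bilinDl _ _ basis_mul) (@bilinDr _ _ basis_mul).

(* The basis element s_U^{F,G}. *)
Definition sbasis F G (U : {group gT F * gT G}) : Lambda :=
  << sindex U >>.

Lemma sbasis_mul F G H (U : {group gT F * gT G}) (V : {group gT G * gT H}) :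
  sbasis U ** sbasis V = sigma U V *: sbasis (star U V).
Proof. by rewrite [LHS]bilinUU basis_mulE. Qed.

Lemma sbasis_mul_neq F G G' H
    (U : {group gT F * gT G}) (V : {group gT G' * gT H}) :
  G != G' -> sbasis U ** sbasis V = 0.
Proof. by move=> neG; rewrite [LHS]bilinUU basis_mul_neq. Qed.

Lemma subgroup_algebraZl (c : K) (x y : Lambda) :
  (c *: x) ** y = c *: (x ** y).
Proof. exact: bilinZl. Qed.

Lemma subgroup_algebraZr (c : K) (x y : Lambda) :
  x ** (c *: y) = c *: (x ** y).
Proof. exact: bilinZr. Qed.

End SubgroupAlgebra.

(* Imported only here because its notations for coefficients and supports clash
   with those of monalg. *)
From mathcomp Require Import mpoly.

(* The elements x j, for j in S, are algebraically independent over the prime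
   field of K; ratr is the embedding of the rationals when K has
   characteristic zero. *)
Definition alg_independent (K : fieldType) (J : Type) (S : J -> Prop)
    (x : J -> K) : Prop :=
  forall n (j : 'I_n -> J), injective j -> (forall i, S (j i)) ->
  forall P : mpoly.mpoly n rat,
    mpoly.mmap (@ratr K) (x \o j) P = 0 -> P = 0.

Definition prime_divisor_of_orders (I : Type) (gT : I -> finGroupType)
    (q : nat) : Prop :=
  exists F : I, prime q /\ (q %| #|[set: gT F]|)%N.

Definition alg_independent_wrt (K : fieldType) (I : Type)
    (gT : I -> finGroupType) (ell : posnat_hom K) : Prop :=
  alg_independent (prime_divisor_of_orders gT) ell.

(* Main.v *)
Require Import Defs.
From mathcomp Require Import all_boot all_order all_algebra all_fingroup.
From mathcomp Require mpoly.
From Stdlib Require Import Classical.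

(** Only finitely many groups of the family occur in a given finite set of
    elements of Lambda, and the sum of the diagonal elements s_{Delta(F)} over
    them is an idempotent u whose corner u Lambda u contains the set and has
    the finite basis s_U, for U ranging over the subgroups of the F * G with F
    and G in the finite list.  This gives local units, and every e Lambda e is
    a corner of such a finite-dimensional algebra A = u Lambda u.

    The trace form of A, which sends (x, y) to the trace of left multiplication
    by xy, is nondegenerate.  Its Gram matrix in the basis s_U has entries that
    are sums of values of ell, so its determinant is an integer polynomial in
    the ell(q), for q prime dividing some group order.  By algebraic
    independence this determinant can only vanish if the polynomial does, hence
    only if it vanishes at every specialisation; and it is nonzero at the
    rational specialisation ell(n) = n^k for k large ([det_sum_specialize]).

    For ell(n) = n^k the nonvanishing is a matter of positivity.  A subgroup U
    of F * G is a relation on the disjoint union of the groups.  Put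
    <s_V, s_W> = |V :&: W|^k: this counts the k-tuples that lie in both
    relations, so it is a Gram matrix C C^T, and it is positive definite once a
    k-tuple can enumerate a whole subgroup.  Left multiplication by s_U has
    left multiplication by s_{U^op} as its adjoint, because
    <s_U s_V, s_W> and <s_V, s_{U^op} s_W> are both the k-th power of the number
    of triples (f, g, h) with (f, g) in U, (g, h) in V and (f, h) in W
    ([sum_mult_number_meet], [card_triangles_opp]).  So the multiplication
    operators form an algebra stable under adjunction, in which tr(L L^* ) is
    positive for L nonzero ([mxtrace_adjoint_eq0], [trace_form_unitmx],
    [rat_trace_form_neq0]).

    Finally, an element of square zero acts with trace zero.  Nondegeneracy
    therefore gives, for every nonzero x in e A e, some y in e A e such that
    (yx)^2 is nonzero, and e A e is artinian since it is finite-dimensional.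
    Such a ring is semisimple by Brauer's lemma: a minimal left ideal is
    generated by an idempotent, hence splits off any left ideal that contains
    it ([artinian_semisimple], [trace_form_corner_semisimple]). *)

Set Implicit Arguments.
Unset Strict Implicit.
Unset Printing Implicit Defensive.

Import GRing.Theory Num.Theory.
Local Open Scope ring_scope.

(** * Artinian rings without square-zero left ideals *)

Section ArtinianSemisimple.
Variable R : pzRingType.
Implicit Types (L N : R -> Prop) (x y z f : R).

Definition left_ideal L := @is_submodule R R^o L.

Definition proper_left_ideal N L : Prop :=
  [/\ left_ideal N, left_ideal L, forall x, N x -> L x
    & exists2 x, L x & ~ N x].

Definition left_artinian : Prop := well_founded proper_left_ideal.

Lemma left_idealD L x y : left_ideal L -> L x -> L y -> L (x + y).
Proof. by case=> _ idL Lx Ly; have := idL 1 x y Lx Ly; rewrite scale1r. Qed.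

Lemma left_idealMl L a x : left_ideal L -> L x -> L (a * x).
Proof. by case=> L0 idL Lx; have := idL a x 0 Lx L0; rewrite addr0. Qed.

Lemma left_idealB L x y : left_ideal L -> L x -> L y -> L (x - y).
Proof.
move=> idL Lx Ly; apply: left_idealD => //.
by rewrite -mulN1r; apply: left_idealMl.
Qed.

Lemma left_ideal_sum L (J : finType) (P : pred J) (y : J -> R) :
  left_ideal L -> (forall i, P i -> L (y i)) -> L (\sum_(i | P i) y i).
Proof.
move=> idL Ly; apply: (big_ind L) => //; first by case: idL.
by move=> a b; apply: left_idealD.
Qed.

Lemma minimal_left_ideal L : left_artinian -> left_ideal L ->
    (exists2 x, L x & x != 0) ->
  exists N, @simple_submodule R R^o N /\ forall x, N x -> L x.
Proof.
move=> artR; elim/(well_founded_ind artR): L => L IH idL nzL.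
have [simL|nsimL] := classic (@simple_submodule R R^o L); first by exists L.
have [N [idN sNL nN0 nLN]] : exists N, [/\ left_ideal N, forall x, N x -> L x,
    ~ (forall x, N x -> x = 0) & ~ (forall x, L x -> N x)].
  apply: NNPP => noN; apply: nsimL; split=> // N idN sNL.
  have [|nN0] := classic (forall x, N x -> x = 0); first by left.
  have [|nLN] := classic (forall x, L x -> N x); first by right.
  by case: noN; exists N.
have [x Lx nNx] : exists2 x, L x & ~ N x.
  by apply: NNPP => no; apply: nLN => x Lx; apply: NNPP => nNx; apply: no; exists x.
have nzN : exists2 y, N y & y != 0.
  apply: NNPP => no; apply: nN0 => y Ny; apply/eqP/negP => /negP nz_y.
  by apply: no; exists y.
have /IH[] // : proper_left_ideal N L by split=> //; exists x.
by move=> M [simM sMN]; exists M; split=> // y /sMN/sNL.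
Qed.

(** Brauer's lemma.  Minimality forces Nz = N, so z = fz for some f in N; it
    also forces the left annihilator of z in N, which contains f^2 - f, to
    vanish.  For x in N, likewise, x - xf is in the left annihilator of f in
    N, which is zero because f is not. *)
Lemma simple_left_ideal_idem N z : @simple_submodule R R^o N ->
    N z -> z * z != 0 ->
  exists f, [/\ N f, f * f = f & forall x, N x -> x * f = x].
Proof.
move=> [idN _ minN] Nz nz_zz.
have id_Nz : left_ideal (fun x => exists2 y, N y & x = y * z).
  split; first by exists 0; [case: idN | rewrite mul0r].
  move=> a _ _ [x Nx ->] [y Ny ->]; exists (a * x + y); last first.
    by rewrite mulrDl -mulrA.
  by apply: left_idealD => //; apply: left_idealMl.
have id_ann : left_ideal (fun x => N x /\ x * z = 0).
  split; first by split; [case: idN | rewrite mul0r].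
  move=> a x y [Nx xz] [Ny yz]; split.
    by apply: left_idealD => //; apply: left_idealMl.
  by rewrite mulrDl -mulrA xz yz mulr0 addr0.
have ann0 x : N x -> x * z = 0 -> x = 0.
  case: (minN _ id_ann) => [? []//|annN|annN Nx xz]; first by auto.
  by have [_ zz0] := annN _ Nz; rewrite zz0 eqxx in nz_zz.
have [f Nf def_z] : exists2 f, N f & z = f * z.
  case: (minN _ id_Nz) => [_ [y Ny ->]|Nz0|sNNz].
  - exact: left_idealMl.
  - by move/eqP: nz_zz; case; apply: Nz0; exists z.
  - exact: sNNz.
have ff : f * f = f.
  apply/eqP; rewrite -subr_eq0; apply/eqP/ann0.
    by apply: left_idealB => //; apply: left_idealMl.
  by rewrite mulrBl -mulrA -!def_z subrr.
have id_annf : left_ideal (fun x => N x /\ x * f = 0).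
  split; first by split; [case: idN | rewrite mul0r].
  move=> a x y [Nx xz] [Ny yz]; split.
    by apply: left_idealD => //; apply: left_idealMl.
  by rewrite mulrDl -mulrA xz yz mulr0 addr0.
exists f; split=> // x Nx.
apply/eqP; rewrite -subr_eq0 -oppr_eq0 opprB; apply/eqP.
case: (minN _ id_annf) => [? []//|annf0|annfN].
- apply: annf0; split; last by rewrite mulrBl -mulrA ff subrr.
  by apply: left_idealB => //; apply: left_idealMl.
- have [_ f0] := annfN _ Nf; move: nz_zz; rewrite def_z -ff f0 !mul0r.
  by rewrite eqxx.
Qed.

Definition internal_direct_sum L m (N : 'I_m -> R -> Prop) : Prop :=
  [/\ forall i x, N i x -> L x,
      forall x, L x ->
        exists y : 'I_m -> R, (forall i, N i (y i)) /\ x = \sum_i y i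
    & forall y : 'I_m -> R,
        (forall i, N i (y i)) -> \sum_i y i = 0 -> forall i, y i = 0].

(** A minimal left ideal of L is Rf with f idempotent, and then
    L = Rf (+) {x in L | xf = 0}: the second summand is a strictly smaller left
    ideal, to which the induction applies. *)
Lemma left_ideal_sum_simple L : left_artinian ->
    (forall x, x != 0 -> exists y, y * x * (y * x) != 0) -> left_ideal L ->
  exists m (N : 'I_m -> R -> Prop),
    (forall i, @simple_submodule R R^o (N i)) /\ internal_direct_sum L N.
Proof.
move=> artR nnilR; elim/(well_founded_ind artR): L => L IH idL.
have [nzL|L0] := classic (exists2 x, L x & x != 0); last first.
  exists 0, (fun _ _ => False); split=> [[]//|]; split=> [[]//|x Lx|y _ _ []//].
  exists (fun=> 0); split=> [[]//|]; rewrite big_ord0; apply/eqP/negP => /negP nzx.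
  by apply: L0; exists x.
have [N [simN sNL]] := minimal_left_ideal artR idL nzL.
have [idN [x0 Nx0 nz_x0] _] := simN.
have [y0 nz_z] := nnilR _ nz_x0.
have [f [Nf ff Nidf]] := simple_left_ideal_idem simN (left_idealMl y0 idN Nx0) nz_z.
pose L' x := L x /\ x * f = 0.
have idL' : left_ideal L'.
  split; first by split; [case: idL | rewrite mul0r].
  move=> a x y [Lx xf] [Ly yf]; split.
    by apply: left_idealD => //; apply: left_idealMl.
  by rewrite mulrDl -mulrA xf yf mulr0 addr0.
have prL' : proper_left_ideal L' L.
  split=> // [x []//|]; exists x0; first exact: sNL.
  by case=> _; rewrite Nidf // => x00; rewrite x00 eqxx in nz_x0.
have [m [N' [simN' [sN'L' L'sum N'free]]]] := IH _ prL' idL'.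
pose N1 i := if unlift ord0 i is Some j then N' j else N.
have N10 : N1 ord0 = N by rewrite /N1 unlift_none.
have N1l j : N1 (lift ord0 j) = N' j by rewrite /N1 liftK.
exists m.+1, N1; split.
  by move=> i; case: (unliftP ord0 i) => [j|] ->; rewrite ?N10 ?N1l.
split=> [i x|x Lx|y Ny sumy].
- case: (unliftP ord0 i) => [j|] ->; rewrite ?N10 ?N1l; last exact: sNL.
  by case/sN'L'.
- have L'x : L' (x - x * f).
    split; last by rewrite mulrBl -mulrA ff subrr.
    by apply: left_idealB => //; apply: left_idealMl => //; apply: sNL.
  have [y [N'y def_x]] := L'sum _ L'x.
  exists (fun i => if unlift ord0 i is Some j then y j else x * f); split.
    move=> i; rewrite /N1; case: unliftP => [j|] _ //.
    exact: left_idealMl.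
  rewrite big_ord_recl unlift_none; under eq_bigr do rewrite liftK.
  by rewrite -def_x addrC subrK.
have N'y j : N' j (y (lift ord0 j)) by rewrite -N1l.
have Ny0 : N (y ord0) by rewrite -N10.
have yo0 : y ord0 = 0.
  have := congr1 (fun x => x * f) sumy; rewrite mul0r big_ord_recl mulrDl.
  rewrite Nidf // mulr_suml big1 ?addr0 // => j _.
  by have /sN'L'[] := N'y j.
move=> i; case: (unliftP ord0 i) => [j|] -> //.
move: sumy; rewrite big_ord_recl yo0 add0r => sumy.
exact: (N'free _ N'y sumy).
Qed.

(** The hypothesis on squares provides the element that is not of square zero
    which Brauer's lemma needs inside each minimal left ideal. *)
Lemma artinian_semisimple : left_artinian ->
    (forall x, x != 0 -> exists y, y * x * (y * x) != 0) ->
  semisimple_ring R.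
Proof.
move=> artR nnilR.
have idR : left_ideal (fun=> True) by split.
have [m [N [simN [_ sumN freeN]]]] := left_ideal_sum_simple artR nnilR idR.
exists 'I_m, N; split=> //; split=> [x|n j y inj_j Ny sumy i].
  by have [y [Ny def_x]] := sumN x I; exists m, id, y.
(* Collects in Y k the only term y i, if any, that lies in N k. *)
pose Y k : R := \sum_(i | j i == k) y i.
have NY k : N k (Y k).
  apply: left_ideal_sum; first by case: (simN k).
  by move=> i0 /eqP <-.
have /(freeN _ NY)/(_ (j i)) : \sum_k Y k = 0.
  by rewrite -[RHS]sumy [RHS](partition_big j xpredT).
by rewrite /Y (big_pred1 i) // => i0; rewrite /= inj_eq.
Qed.

End ArtinianSemisimple.

(** The rank of a family of coordinate vectors of elements of L measures the
    size of L; a proper inclusion of left ideals strictly decreases the largest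
    rank, because a vector outside a subspace can be added to a free family. *)
Lemma artinian_of_coordinates (K : fieldType) (R : pzRingType) n
    (phi : R -> 'rV[K]_n) :
    {morph phi : x y / x - y} -> (forall x, phi x = 0 -> x = 0) ->
    (forall L : R -> Prop, left_ideal L -> forall c x, L x ->
       exists2 y, L y & phi y = c *: phi x) ->
  left_artinian R.
Proof.
move=> phiB phi_inj phiZ.
have phi0 : phi 0 = 0 by rewrite -(subrr 0) phiB subrr.
have phiD x y : phi (x + y) = phi x + phi y.
  by rewrite -[y in LHS]opprK phiB -sub0r phiB phi0 sub0r opprK.
pose bounded (L : R -> Prop) d := forall m (A : 'M[K]_(m, n)),
  (forall i, exists2 x, L x & phi x = row i A) -> (\rank A <= d)%N.
have AccL d L : left_ideal L -> bounded L d -> Acc (@proper_left_ideal R) L.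
  elim: d L => [|d IH] L idL bdL; constructor=> N [idN _ sNL [x Lx nNx]].
    suff /phi_inj x0 : phi x = 0 by case: nNx; rewrite x0; case: idN.
    apply/eqP; rewrite -mxrank_eq0 -leqn0; apply: bdL => i.
    by exists x => //; apply/rowP => k; rewrite mxE ord1.
  apply: IH => // m A rowA; rewrite -ltnS.
  apply: leq_trans (_ : (\rank A < \rank (col_mx A (phi x)))%N) _; last first.
    apply: bdL => i; case: (splitP i) => k eq_ik.
      have -> : i = lshift 1 k by apply: val_inj.
      have [y Ny phi_y] := rowA k; exists y; first exact: sNL.
      by rewrite phi_y rowKu.
    have -> : i = rshift m k by apply: val_inj.
    by exists x => //; rewrite rowKd; apply/rowP => l; rewrite mxE ord1.
  rewrite -addsmxE; apply: rank_ltmx; rewrite ltmxE addsmxSl /=.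
  apply/negP => /(submx_trans (addsmxSr _ _)) /submxP[D phi_x].
  have [y Ny phi_y] : exists2 y, N y & phi y = D *m A.
    rewrite mulmx_sum_row; elim/big_ind: _.
    - by exists 0 => //; case: idN.
    - move=> _ _ [y Ny <-] [z Nz <-]; exists (y + z); last by rewrite phiD.
      exact: left_idealD.
    - by move=> i _; have [y Ny <-] := rowA i; apply: phiZ.
  have /phi_inj/eqP : phi (x - y) = 0 by rewrite phiB phi_y phi_x subrr.
  by rewrite subr_eq0 => /eqP xy; case: nNx; rewrite xy.
move=> L; constructor=> N [idN _ _ _]; apply: (AccL n) => // m A _.
exact: rank_leq_col.
Qed.

(** * Trace forms of operator algebras stable under adjunction *)

Section TraceForms.

(** With A = CR the full rank factorisation, A^2 = 0 forces RC = 0, and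
    tr(CR) = tr(RC). *)
Lemma mxtrace_sqr0 (K : fieldType) n (A : 'M[K]_n) : A *m A = 0 -> \tr A = 0.
Proof.
move=> AA0; rewrite -[A]mulmx_base mxtrace_mulC.
suff -> : row_base A *m col_base A = 0 by rewrite mxtrace0.
apply: (row_free_inj (row_base_free A)); rewrite mul0mx -mulmxA.
apply: (row_full_inj (col_base_full A)).
by rewrite mulmx0 mulmx_base mulmxA mulmx_base.
Qed.

Lemma unitmx_inj (K : fieldType) n (A : 'M[K]_n) :
  (forall x : 'rV_n, x *m A = 0 -> x = 0) -> A \in unitmx.
Proof.
move=> A_inj; rewrite -row_free_unit -kermx_eq0.
by apply/rowV0P => x /sub_kermxP; apply: A_inj.
Qed.

Variable F : realFieldType.

Lemma mxtrace_mul_tr_eq0 m n (A : 'M[F]_(m, n)) : \tr (A *m A^T) = 0 -> A = 0.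
Proof.
have trE : \tr (A *m A^T) = \sum_i \sum_j A i j ^+ 2.
  by apply: eq_bigr => i _; rewrite mxE; apply: eq_bigr => j _; rewrite !mxE.
have ge0 i : 0 <= \sum_j A i j ^+ 2 by apply: sumr_ge0 => j _; apply: sqr_ge0.
move=> tr0; move: trE; rewrite tr0 => /esym/eqP.
rewrite psumr_eq0 // => /allP row0; apply/matrixP => i j; rewrite mxE.
have /eqP/eqP := row0 i (mem_index_enum i).
rewrite psumr_eq0 => [/allP/(_ j (mem_index_enum j))|k _]; last exact: sqr_ge0.
by rewrite /= sqrf_eq0 => /eqP.
Qed.

Variables (n m : nat) (C : 'M[F]_(n, m)).
Hypothesis C_inj : forall x : 'rV_n, x *m C = 0 -> x = 0.
Let B := C *m C^T.

Lemma gram_unitmx : B \in unitmx.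
Proof.
apply: unitmx_inj => x xB0; apply/C_inj/mxtrace_mul_tr_eq0.
by rewrite trmx_mul mulmxA -(mulmxA x) xB0 mul0mx mxtrace0.
Qed.

(** L' is the adjoint B^-1 L^T B of L for the scalar product B = C C^T.  Writing
    B^-1 = D D^T turns tr(L L') into tr(Y Y^T) for Y = C^T L D, a sum of squares;
    this avoids the square root of B, which need not exist over F. *)
Lemma mxtrace_adjoint_eq0 (L L' : 'M[F]_n) :
  B *m L' = L^T *m B -> \tr (L *m L') = 0 -> L = 0.
Proof.
have uB := gram_unitmx; have trB : B^T = B by rewrite trmx_mul trmxK.
pose D := invmx B *m C.
have DD : D *m D^T = invmx B.
  by rewrite trmx_mul trmx_inv trB mulmxA -(mulmxA _ C) -/B mulVmx // mul1mx.
clearbody D; move=> adjL tr0; have defL' : L' = invmx B *m (L^T *m B).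
  by rewrite -adjL mulmxA mulVmx // mul1mx.
have CLD : C^T *m (L *m D) = 0.
  apply: mxtrace_mul_tr_eq0; rewrite -mulmxA mxtrace_mulC -[RHS]tr0 defL'.
  by rewrite -DD /B !trmx_mul trmxK !mulmxA.
have BLB : B *m L *m invmx B = 0.
  by rewrite -DD /B -!mulmxA (mulmxA L) (mulmxA C^T) CLD mul0mx mulmx0.
by rewrite -(mulKmx uB L) -(mulmxKV uB (B *m L)) BLB mul0mx mulmx0.
Qed.

(** The adjoint of L_x = \sum_i x_i L_i is the combination of the L (conv i) with
    the same coefficients.  Hence, if x is in the kernel of the trace form, then
    tr(L_x L_x^* ) = 0. *)
Lemma trace_form_unitmx (L : 'I_n -> 'M[F]_n) (conv : 'I_n -> 'I_n) :
    (forall x : 'rV_n, \sum_i x 0 i *: L i = 0 -> x = 0) ->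
    (forall i, B *m L (conv i) = (L i)^T *m B) ->
  \matrix_(i, j) \tr (L i *m L j) \in unitmx.
Proof.
move=> L_inj adjL; apply: unitmx_inj => x xG0; apply: L_inj.
apply: (@mxtrace_adjoint_eq0 _ (\sum_i x 0 i *: L (conv i))).
  rewrite mulmx_sumr linear_sum mulmx_suml; apply: eq_bigr => i _ /=.
  by rewrite -scalemxAr adjL linearZ -scalemxAl.
rewrite mulmx_sumr linear_sum big1 //= => j _.
rewrite -scalemxAr linearZ /= mulmx_suml linear_sum /=.
have /rowP/(_ (conv j)) := xG0; rewrite !mxE => xGj.
rewrite -[RHS](mulr0 (x 0 j)); congr (_ * _); rewrite -[RHS]xGj.
by apply: eq_bigr => i _; rewrite mxE -scalemxAl linearZ.
Qed.

End TraceForms.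

(** * Specialising algebraically independent values *)

Section Specialization.
Import mpoly.

Lemma prod_primes_morph (K : fieldType) (f : nat -> K) (ps : seq nat) m :
    f 1 = 1 ->
    (forall a b, (0 < a)%N -> (0 < b)%N -> f (a * b)%N = f a * f b) ->
    uniq ps -> (0 < m)%N -> {subset primes m <= ps} ->
  \prod_(i < size ps) f (nth 0 ps i) ^+ logn (nth 0 ps i) m = f m.
Proof.
move=> f1 fM uniq_ps m_gt0 sub_ps.
have fX p e : (0 < p)%N -> f (p ^ e)%N = f p ^+ e.
  move=> p_gt0; elim: e => [|e IHe]; first by rewrite f1 expr0.
  by rewrite expnS fM ?expn_gt0 ?p_gt0 // IHe exprS.
transitivity (\prod_(p <- ps) f p ^+ logn p m).
  by rewrite (big_nth 0) big_mkord.
rewrite (bigID (fun p => p \in primes m)) /= [X in _ * X]big1 ?mulr1; last first.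
  by move=> p; rewrite -logn_gt0 -eqn0Ngt => /eqP ->; rewrite expr0.
rewrite -big_filter (perm_big (primes m)) /=; last first.
  apply: uniq_perm; rewrite ?filter_uniq ?primes_uniq // => p.
  by rewrite mem_filter; apply/andb_idr/sub_ps.
pose P x y := x = f y /\ (0 < y)%N.
have m_prod : m = (\prod_(p <- primes m) p ^ logn p m)%N.
  by rewrite {1}(prod_prime_decomp m_gt0) prime_decompE big_map.
suff [eqf _] : P (\prod_(p <- primes m) f p ^+ logn p m)
            (\prod_(p <- primes m) p ^ logn p m)%N.
  by rewrite eqf -m_prod.
rewrite !big_seq.
apply: (big_ind2 P) => [|x y x' y' [-> y0] [-> y'0]|p pm]; first by [].
  by split; rewrite ?fM ?muln_gt0 ?y0.
have p_gt0 : (0 < p)%N by move: pm; rewrite mem_primes => /andP[/prime_gt0].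
by split; rewrite ?fX // expn_gt0 p_gt0.
Qed.

(** Structure constants of the algebra are either zero or values of ell; with the
    convention that 0 goes to 0 both are values of one multiplicative
    function. *)
Definition zero_ext (K : fieldType) (ell : nat -> K) m : K :=
  if m == 0 then 0 else ell m.

Lemma zero_extM (K : fieldType) (ell : posnat_hom K) a b :
  zero_ext ell (a * b) = zero_ext ell a * zero_ext ell b.
Proof.
rewrite /zero_ext muln_eq0; have [->|a0] := eqVneq a 0; first by rewrite /= mul0r.
have [->|b0] := eqVneq b 0; first by rewrite orbT mulr0.
by rewrite posnat_funM ?lt0n.
Qed.

(** Both determinants are values of one polynomial P with integer coefficients,
    in variables standing for the primes that divide the M i j t: the variables
    are sent to ell(q), respectively to q^k.  Algebraic independence turns a zero
    of P at the ell(q) into P = 0. *)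
Lemma det_sum_specialize (K : fieldType) (S : nat -> Prop) (ell : posnat_hom K)
    n (J : finType) (M : 'I_n -> 'I_n -> J -> nat) k :
    alg_independent S ell -> (0 < k)%N ->
    (forall i j t p, prime p -> (0 < M i j t)%N -> (p %| M i j t)%N -> S p) ->
    \det (\matrix_(i, j) \sum_t ((M i j t ^ k)%:R : rat)) != 0 ->
  \det (\matrix_(i, j) \sum_t zero_ext ell (M i j t)) != 0.
Proof.
move=> indep k_gt0 primesM.
pose ps := undup (flatten [seq primes (M x.1.1 x.1.2 x.2)
                          | x <- enum {: 'I_n * 'I_n * J}]).
have ps_sub i j t : {subset primes (M i j t) <= ps}.
  move=> p pM; rewrite mem_undup; apply/flattenP.
  exists (primes (M i j t)) => //; apply/mapP; exists (i, j, t) => //.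
  by rewrite mem_enum.
pose q (i : 'I_(size ps)) := nth 0 ps i.
have q_inj : injective q.
  move=> i j /eqP; rewrite nth_uniq ?undup_uniq // => /eqP.
  exact: val_inj.
have Sq i : S (q i).
  have: q i \in ps by apply: mem_nth.
  rewrite mem_undup => /flattenP[_ /mapP[x _ ->]].
  by rewrite mem_primes => /and3P[]; apply: primesM.
pose mono m : {mpoly int[size ps]} :=
  if m == 0 then 0 else 'X_[[multinom logn (q i) m | i < size ps]].
pose P : {mpoly int[size ps]} := \det (\matrix_(i, j) \sum_t mono (M i j t)).
have evalP (L : fieldType) (f : nat -> L) : f 1 = 1 ->
    (forall a b, (0 < a)%N -> (0 < b)%N -> f (a * b)%N = f a * f b) ->
  mmap intr (f \o q) P = \det (\matrix_(i, j) \sum_t zero_ext f (M i j t)).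
- move=> f1 fM; rewrite /P -det_map_mx; congr (\det _).
  apply/matrixP => i j; rewrite !mxE raddf_sum; apply: eq_bigr => t _ /=.
  rewrite /mono /zero_ext; have [|M0] := eqVneq; first by rewrite mmap0.
  rewrite mmapX -[RHS](prod_primes_morph f1 fM (undup_uniq _) _ (ps_sub i j t)).
    by apply: eq_bigr => l _; rewrite mnmE.
  by rewrite lt0n.
rewrite -(evalP K ell (posnat_fun1 ell) (posnat_funM ell)) => detQ.
apply: contraNneq detQ => ellP0.
have P0 : map_mpoly intr P = 0 :> {mpoly rat[size ps]}.
  apply: (indep _ q q_inj Sq); rewrite -[RHS]ellP0.
  rewrite /mmap (perm_big (msupp P)) /=.
    by apply: eq_bigr => m _; rewrite mcoeff_map_mpoly /= ratr_int.
  exact/msupp_map_mpoly/intr_inj.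
have PZ0 : P = 0.
  by apply/mpolyP => m; apply: (@intr_inj rat); rewrite -mcoeff_map_mpoly P0 !mcoeff0.
pose powk m : rat := (m ^ k)%:R.
have -> : \matrix_(i, j) \sum_t (M i j t ^ k)%:R =
          \matrix_(i, j) \sum_t zero_ext powk (M i j t) :> 'M[rat]_n.
  apply/matrixP => i j; rewrite !mxE; apply: eq_bigr => t _.
  by rewrite /zero_ext; case: eqP => [->|//]; rewrite exp0n.
rewrite -evalP ?PZ0 ?mmap0 // => [|a b _ _]; first by rewrite /powk exp1n.
by rewrite /powk expnMn natrM.
Qed.

End Specialization.

(** * Subgroups of direct products as relations *)

Definition diag_set (F : finGroupType) : {set F * F} := [set x | x.1 == x.2].

Lemma diag_group_set (F : finGroupType) : group_set (diag_set F).
Proof.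
apply/group_setP; split=> [|x y]; rewrite !inE //=.
by move=> /eqP -> /eqP ->.
Qed.

Definition diag (F : finGroupType) : {group F * F} := Group (diag_group_set F).

Lemma star_diag (F G : finGroupType) (U : {group F * G}) : star U (diag G) = U.
Proof.
apply/val_inj/setP => -[f g]; apply/star_setP/idP => [[g' []]|Ug].
  by rewrite inE => Ug /eqP/= <-.
by exists g; rewrite inE.
Qed.

Lemma diag_star (F G : finGroupType) (U : {group F * G}) : star (diag F) U = U.
Proof.
apply/val_inj/setP => -[f g]; apply/star_setP/idP => [[f' []]|Ug].
  by rewrite inE => /eqP/= ->.
by exists f; rewrite inE.
Qed.

Lemma meet_order_diag (F G : finGroupType) (U : {group F * G}) :
  meet_order U (diag G) = 1.
Proof.
apply/eqP/cards1P; exists 1%g; apply/setP => g; rewrite !inE /=.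
by have [->|] := eqVneq g 1%g; rewrite ?group1 ?andbF.
Qed.

Lemma meet_order_diag_left (F G : finGroupType) (U : {group F * G}) :
  meet_order (diag F) U = 1.
Proof.
apply/eqP/cards1P; exists 1%g; apply/setP => g; rewrite !inE /= eq_sym.
by have [->|] := eqVneq g 1%g; rewrite ?group1 ?andbF.
Qed.

Definition opp_set (F G : finGroupType) (U : {set F * G}) : {set G * F} :=
  [set x | (x.2, x.1) \in U].

Lemma opp_group_set (F G : finGroupType) (U : {group F * G}) : group_set (opp_set U).
Proof.
apply/group_setP; split=> [|x y]; rewrite !inE ?group1 //= => Ux Uy.
by rewrite -pairM groupM.
Qed.

Section StructureNumbers.
Variables (T : finType) (gT : T -> finGroupType).
Local Notation tel := {F : T & gT F}.
Local Notation sub_idx := {FG : T * T & {group gT FG.1 * gT FG.2}}.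
Implicit Types (a u v w : sub_idx) (x y z : tel).

Local Notation elt F g := (existT (fun G => FinGroup.sort (gT G)) F g).
Local Notation sidx U := (@sindex T gT _ _ U : sub_idx).

(** The coefficient of s_u in s_a s_v is the value of ell at this number, read as
    0 if the number is 0.  Keeping the number itself makes it possible to
    compare the algebras given by different ell. *)
Definition mult_number a v u : nat :=
  let: existT (F, G) U := a in
  let: existT (G', H) V := v in
  if G =P G' is ReflectT eqG then
    let U' := ecast G {group gT F * gT G} eqG U in
    if sidx (star U' V) == u then meet_order U' V else 0
  else 0.

Lemma mult_numberE F G H (U : {group gT F * gT G}) (V : {group gT G * gT H}) u :
  mult_number (sidx U) (sidx V) u =
    if sidx (star U V) == u then meet_order U V else 0.
Proof.
by rewrite /mult_number /=; case: eqP => [eqG|[]]; first rewrite (eq_axiomK eqG).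
Qed.

Lemma mult_number_neq F G G' H
    (U : {group gT F * gT G}) (V : {group gT G' * gT H}) u :
  G != G' -> mult_number (sidx U) (sidx V) u = 0.
Proof. by rewrite /mult_number /=; case: eqP. Qed.

Arguments mult_number : simpl never.

Lemma sub_idxP a : exists F G (U : {group gT F * gT G}), a = sidx U.
Proof. by case: a => -[F G] U; exists F, G, U. Qed.

Lemma mult_number_prime a v u p : (0 < mult_number a v u)%N ->
  (p %| mult_number a v u)%N -> exists F, (p %| #|[set: gT F]|)%N.
Proof.
have [F [G [U ->]]] := sub_idxP a; have [G' [H [V ->]]] := sub_idxP v.
have [eqG|neG] := eqVneq G G'; last by rewrite mult_number_neq.
subst G'; rewrite mult_numberE; case: eqP => // _ _ p_dvd.
have gM : group_set (rbullet U :&: lbullet V).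
  apply/group_setP; split=> [|g h]; rewrite !inE ?group1 //.
  move=> /andP[Ug Vg] /andP[Uh Vh].
  have := groupM Ug Uh; have := groupM Vg Vh.
  by rewrite !pairM !mulg1 => -> ->.
exists G; apply: dvdn_trans p_dvd _.
exact: (cardSg (subsetT (Group gM))).
Qed.

Definition rdiag a : sub_idx := sidx (diag (gT (tag a).2)).

(** The column of s_{Delta(G)} in the matrix of left multiplication by x shows
    the coefficients of x at the subgroups with right group G; this makes the
    regular representation faithful. *)
Lemma mult_number_rdiag a u : mult_number a (rdiag u) u = (a == u).
Proof.
have [F [G [U ->]]] := sub_idxP a; have [F' [G' [U' ->]]] := sub_idxP u.
rewrite /rdiag /=.
have [eqG|neG] := eqVneq G G'.
  subst G'; rewrite mult_numberE star_diag meet_order_diag.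
  by case: (sidx U == _).
rewrite mult_number_neq //; case: eqP => // /(congr1 tag) [_ eqG].
by rewrite eqG eqxx in neG.
Qed.

Definition opp_idx a : sub_idx :=
  let: existT (F, G) U := a in sidx (Group (opp_group_set U)).

(** Pairs of elements of the disjoint union of the groups: in this form
    subgroups of different F * G can be intersected (with empty result), and
    the pair of identity elements determines F and G. *)
Definition relation a : {set tel * tel} :=
  [set ((elt (tag a).1 p.1 : tel), (elt (tag a).2 p.2 : tel))
     | p in (tagged a : {set _})].

Lemma relationP F G (U : {group gT F * gT G}) x y :
  reflect (exists f g, [/\ (f, g) \in U, x = elt F f & y = elt G g])
          ((x, y) \in relation (sidx U)).
Proof.
apply: (iffP imsetP) => [[[f g] /= Ufg [-> ->]]|[f [g [Ufg -> ->]]]].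
  by exists f, g.
by exists (f, g).
Qed.

Lemma elt_inj F : injective (fun g : gT F => elt F g : tel).
Proof.
move=> g h /eqP; rewrite -[elt F h]/(Tagged (fun G => FinGroup.sort (gT G)) h).
by rewrite eq_Tagged /= => /eqP.
Qed.

Lemma relationE F G (U : {group gT F * gT G}) f g :
  ((elt F f, elt G g) \in relation (sidx U)) = ((f, g) \in U).
Proof.
apply/relationP/idP => [[f' [g' [Ufg]]]|Ufg]; last by exists f, g.
by move=> /elt_inj -> /elt_inj ->.
Qed.

Lemma relation_inj : injective relation.
Proof.
move=> a v; have [F [G [U ->]]] := sub_idxP a.
have [F' [G' [V ->]]] := sub_idxP v => eqR.
have : (elt F 1%g, elt G 1%g) \in relation (sidx V) by rewrite -eqR relationE (group1 U).
case/relationP => [f [g [_ /(congr1 tag)/= eqF /(congr1 tag)/= eqG]]].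
subst F' G'; congr (sidx _); apply/val_inj/setP => -[h k].
by rewrite -[LHS]relationE eqR relationE.
Qed.

Lemma relation_neq0 a : exists r, r \in relation a.
Proof.
have [F [G [U ->]]] := sub_idxP a.
by exists (elt F 1%g, elt G 1%g); rewrite relationE (group1 U).
Qed.

Lemma relation_opp a x y :
  ((x, y) \in relation (opp_idx a)) = ((y, x) \in relation a).
Proof.
have [F [G [U ->]]] := sub_idxP a.
apply/relationP/relationP => -[g [f [Ufg -> ->]]]; exists f, g.
  by move: Ufg; rewrite inE.
by rewrite inE.
Qed.

Definition triangles a v w : {set tel * tel * tel} :=
  [set t | [&& (t.1.1, t.1.2) \in relation a, (t.1.2, t.2) \in relation v
             & (t.1.1, t.2) \in relation w]].

Lemma card_triangles_opp a v w : #|triangles (opp_idx a) w v| = #|triangles a v w|.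
Proof.
pose s (t : tel * tel * tel) := (t.1.2, t.1.1, t.2).
have sK : involutive s by case=> [[]].
rewrite -(card_imset _ (inv_inj sK)); apply: eq_card => -[[x y] z].
rewrite -[X in X \in _ = _](sK (x, y, z)) mem_imset ?inE //=; last exact: inv_inj.
by rewrite relation_opp; congr (_ && _); rewrite andbC.
Qed.

(** Over each pair (f, h) of the star product, the possible middle elements g
    form a coset of the meet of U_bullet and bullet_V. *)
Lemma card_triangles_star F G H (U : {group gT F * gT G})
    (V : {group gT G * gT H}) w :
  #|triangles (sidx U) (sidx V) w| =
    (meet_order U V * #|relation (sidx (star U V)) :&: relation w|)%N.
Proof.
pose p (t : tel * tel * tel) := (t.1.1, t.2).
rewrite -sum1_card (partition_big p (mem (relation (sidx (star U V)) :&: relation w))).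
  rewrite mulnC -sum_nat_const; apply: eq_bigr => -[x z] /setIP[].
  case/relationP => f [h [/star_setP[g [Ug Vg]] -> ->]] wxz.
  pose ins k := (elt F f : tel, elt G (g * k)%g : tel, elt H h : tel).
  have ins_inj : injective ins by move=> k k' [] /elt_inj/mulgI.
  rewrite sum1dep_card /meet_order -(card_imset _ ins_inj).
  apply: eq_card => -[[x' y] z'].
  rewrite inE inE /= andbC; apply/andP/imsetP => [|[k Mk [-> -> ->]]].
    case=> /eqP[-> ->] /and3P[/relationP[f1 [g1 [Ug1 /elt_inj eqf ->]]]].
    subst f1.
    rewrite relationE => Vg1 _; exists (g^-1 * g1)%g; last by rewrite /ins mulKVg.
    have := groupM (groupVr Ug) Ug1; have := groupM (groupVr Vg) Vg1.
    by rewrite !inE /= !pairM !mulVg => -> ->.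
  move: Mk; rewrite !inE /= => /andP[Uk Vk]; split; first by [].
  rewrite wxz andbT !relationE -[f]mulg1 -[h]mulg1 -!pairM.
  by rewrite !groupM.
move=> [[x y] z]; rewrite !inE /= => /and3P[].
case/relationP=> f [g [Ug -> ->]] /relationP[g' [h [Vg /elt_inj eqg ->]]] ->.
rewrite andbT relationE; apply/star_setP; exists g; split=> //.
by rewrite eqg.
Qed.

(** The left side is the scalar product <s_a s_v, s_w>, for
    ell(n) = n^k and <s_u, s_w> = |u :&: w|^k. *)
Lemma sum_mult_number_meet a v w k : (0 < k)%N ->
  (\sum_u mult_number a v u ^ k * #|relation u :&: relation w| ^ k =
   #|triangles a v w| ^ k)%N.
Proof.
move=> k_gt0.
have [F [G [U ->]]] := sub_idxP a; have [G' [H [V ->]]] := sub_idxP v.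
have [eqG|neG] := eqVneq G G'.
  subst G'; rewrite (bigD1 (sidx (star U V))) //= mult_numberE eqxx.
  rewrite big1 ?addn0 ?card_triangles_star ?expnMn // => u.
  by rewrite eq_sym mult_numberE => /negPf ->; rewrite exp0n.
rewrite big1 => [|u _]; last by rewrite mult_number_neq // exp0n.
suff -> : triangles (sidx U) (sidx V) w = set0 by rewrite cards0 exp0n.
apply/setP => -[[x y] z]; rewrite !inE /=; apply/negP => /and3P[].
case/relationP=> f [g [_ _ ->]] /relationP[g' [h [_ /(congr1 tag)/= eqG]]].
by rewrite eqG eqxx in neG.
Qed.

Local Notation dim := #|{: sub_idx}|.

Lemma sum_enum_val (V : nmodType) (f : sub_idx -> V) :
  \sum_(i < dim) f (enum_val i) = \sum_u f u.
Proof. by rewrite -(big_enum_val f). Qed.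

(** The (i, j) entry of the Gram matrix of the trace form is the sum of ell over
    these numbers (0 contributing 0), t running over the pairs of matrix indices
    that contribute to the trace of a product. *)
Definition trace_number (i j : 'I_dim) (t : 'I_dim * 'I_dim) : nat :=
  (mult_number (enum_val i) (enum_val t.2) (enum_val t.1) *
   mult_number (enum_val j) (enum_val t.1) (enum_val t.2))%N.

Lemma mxtrace_mult_number (F : nzRingType) (f : nat -> F)
    (L : 'I_dim -> 'M[F]_dim) :
    {morph f : a b / (a * b)%N >-> a * b} ->
    (forall i s t, L i s t =
       f (mult_number (enum_val i) (enum_val t) (enum_val s))) ->
  \matrix_(i, j) \tr (L i *m L j) = \matrix_(i, j) \sum_t f (trace_number i j t).
Proof.
move=> fM LE; apply/matrixP => i j; rewrite !mxE.
rewrite -(pair_bigA _ (fun s t => f (trace_number i j (s, t)))) /=.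
apply: eq_bigr => s _; rewrite mxE; apply: eq_bigr => t _.
by rewrite !LE fM.
Qed.

(** The exponent k exceeds the size of every relation, so that every relation is
    the set of entries of a k-tuple. *)
Lemma rat_trace_form_neq0 (k := #|{: tel * tel}|.+1) :
  \det (\matrix_(i, j) \sum_t ((trace_number i j t ^ k)%:R : rat)) != 0.
Proof.
pose b (i : 'I_dim) : sub_idx := enum_val i.
pose L i : 'M[rat]_dim := \matrix_(s, t) (mult_number (b i) (b t) (b s) ^ k)%:R.
rewrite -(@mxtrace_mult_number _ (fun m => (m ^ k)%:R) L); first last.
- by move=> i s t; rewrite mxE.
- by move=> x y; rewrite expnMn natrM.
pose p := #|{: {ffun 'I_k -> tel * tel}}|.
pose C : 'M[rat]_(dim, p) :=
  \matrix_(i, t) ((enum_val t : {ffun _}) \in ffun_on (relation (b i)))%:R.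
have CCE i j : (C *m C^T) i j = (#|relation (b i) :&: relation (b j)| ^ k)%:R.
  rewrite mxE; under eq_bigr do rewrite !mxE -natrM mulnb.
  rewrite -(big_enum_val (fun t : {ffun 'I_k -> tel * tel} =>
     ((t \in ffun_on (relation (b i))) && (t \in ffun_on (relation (b j))))%:R)).
  rewrite -natr_sum; congr (_%:R); rewrite -[k in RHS]card_ord -card_ffun_on.
  rewrite -sum1_card [RHS]big_mkcond; apply: eq_bigr => t _ /=.
  suff -> : (t \in ffun_on (relation (b i) :&: relation (b j))) =
    (t \in ffun_on (relation (b i))) && (t \in ffun_on (relation (b j))) by case: ifP.
  apply/ffun_onP/andP => [tij|[/ffun_onP ti /ffun_onP tj] l]; last by rewrite inE ti tj.
  by split; apply/ffun_onP => l; have := tij l; rewrite inE => /andP[].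
have C_inj (x : 'rV_dim) : x *m C = 0 -> x = 0.
  move=> xC0; apply/eqP/contraT => /rV0Pn[i0 nz_i0].
  (* For t enumerating a relation of maximal size in the support of x, the
     entry of x C at t is the coefficient of x at that relation alone.  The
     entries of t past the end of the enumeration repeat an element r0 of it. *)
  have [i nz_i max_i] := @arg_maxnP _ i0 (fun i => x 0 i != 0)
    (fun i => #|relation (b i)|) nz_i0.
  have [r0 r0i] := relation_neq0 (b i).
  pose t : {ffun 'I_k -> tel * tel} :=
    [ffun l : 'I_k => nth r0 (enum (relation (b i))) l].
  have t_on j : (t \in ffun_on (relation (b j))) =
                (relation (b i) \subset relation (b j)).
    apply/ffun_onP/subsetP => [tj r ri|sij l]; last first.
      rewrite ffunE; apply: sij.
      have [l_lt|l_ge] := ltnP l (size (enum (relation (b i)))).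
        by rewrite -mem_enum mem_nth.
      by rewrite nth_default.
    have r_lt : (index r (enum (relation (b i))) < k)%N.
      rewrite ltnS; apply: leq_trans (index_size _ _) _.
      by rewrite -cardE max_card.
    by have := tj (Ordinal r_lt); rewrite ffunE nth_index ?mem_enum.
  have /rowP/(_ (enum_rank t)) := xC0; rewrite !mxE (bigD1 i) //=.
  rewrite mxE enum_rankK t_on subxx mulr1 big1 ?addr0 => [/eqP xi0|j ne_ji].
    by rewrite xi0 in nz_i.
  rewrite mxE enum_rankK t_on; have [sij|_] := boolP (_ \subset _); last by rewrite mulr0.
  have [->|nz_j] := eqVneq (x 0 j) 0; first by rewrite mul0r.
  case/eqP: ne_ji; apply/enum_val_inj/relation_inj/esym/eqP.
  by rewrite eqEcard sij; apply: max_i.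
rewrite -unitfE -unitmxE.
apply: (trace_form_unitmx C_inj (conv := fun i => enum_rank (opp_idx (b i)))) => [x|i].
  move=> xL0; apply/rowP => i.
  have /matrixP/(_ i (enum_rank (rdiag (b i)))) := xL0; rewrite summxE !mxE => <-.
  rewrite (bigD1 i) //= big1 ?addr0 => [|j ne_ji].
    by rewrite !mxE /b enum_rankK mult_number_rdiag eqxx exp1n mulr1.
  rewrite !mxE /b enum_rankK mult_number_rdiag (inj_eq enum_val_inj).
  by rewrite (negPf ne_ji) exp0n // mulr0.
apply/matrixP => v w; rewrite !mxE.
transitivity ((#|triangles (b i) (b v) (b w)| ^ k)%:R : rat).
  rewrite -card_triangles_opp -sum_mult_number_meet // natr_sum -sum_enum_val.
  apply: eq_bigr => u _; rewrite CCE !mxE /b enum_rankK mulrC -natrM.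
  by rewrite setIC.
rewrite -sum_mult_number_meet // natr_sum -sum_enum_val.
by apply: eq_bigr => u _; rewrite CCE !mxE -natrM.
Qed.

End StructureNumbers.

(** * Corners of algebras with a nondegenerate trace form *)

Local Open Scope rng_scope.

Section RngSums.
Variables (A : rngType) (J : Type) (r : seq J) (P : pred J) (f : J -> A) (x : A).

Lemma rmul_suml : (\sum_(i <- r | P i) f i) ** x = \sum_(i <- r | P i) f i ** x.
Proof. exact: (big_morph (fun y => y ** x) (fun y z => rmulDl y z x) (rmul0l x)). Qed.

Lemma rmul_sumr : x ** (\sum_(i <- r | P i) f i) = \sum_(i <- r | P i) x ** f i.
Proof. exact: (big_morph (rmul x) (rmulDr x) (rmul0r x)). Qed.

End RngSums.

Lemma rmul_sandwichD (A : rngType) (e x y : A) :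
  e ** (x + y) ** e = e ** x ** e + e ** y ** e.
Proof. by rewrite rmulDr rmulDl. Qed.

(** Here b is a basis of the corner of one over K, with coordinates coord.  As A
    is only a ring, the action of K is a function scale. *)
Section TraceFormCriterion.
Variables (K : fieldType) (A : rngType) (n : nat) (one e : Defs.idempotent A).
Variables (scale : K -> A -> A) (b : 'I_n -> A) (coord : 'I_n -> A -> K).
Implicit Types x y z : A.

Hypothesis scaleMl : forall d x y, scale d x ** y = scale d (x ** y).
Hypothesis scaleMr : forall d x y, x ** scale d y = scale d (x ** y).
Hypothesis coordB : forall i, {morph coord i : x y / x - y}.
Hypothesis coordZ : forall i d x, coord i (scale d x) = d * coord i x.
Hypothesis b_corner : forall i, b i \in corner_pred one.
Hypothesis expand : forall x, x \in corner_pred one ->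
  x = \sum_i scale (coord i x) (b i).
Hypothesis e_corner : (e : A) \in corner_pred one.

Lemma coord0 i : coord i 0 = 0.
Proof. by rewrite -(subrr 0) coordB subrr. Qed.

Lemma coordD i : {morph coord i : x y / x + y}.
Proof.
move=> x y; rewrite -[y in LHS]opprK coordB -sub0r coordB coord0.
by rewrite sub0r opprK.
Qed.

Lemma coord_sum i (J : Type) (r : seq J) (P : pred J) (f : J -> A) :
  coord i (\sum_(j <- r | P j) f j) = \sum_(j <- r | P j) coord i (f j).
Proof. exact: (big_morph (coord i) (coordD i) (coord0 i)). Qed.

Lemma coord_inj x : x \in corner_pred one -> (forall i, coord i x = 0) -> x = 0.
Proof.
move=> ex x0; rewrite [x]expand // [RHS]expand ?rpred0 //.
by apply: eq_bigr => i _; rewrite x0 coord0.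
Qed.

Lemma corner_predM x y : x \in corner_pred one -> y \in corner_pred one ->
  x ** y \in corner_pred one.
Proof.
by move=> ex ey; have := corner_mul_subproof (Corner ex) (Corner ey).
Qed.

Definition left_mx x : 'M[K]_n := \matrix_(i, j) coord i (x ** b j).

Lemma left_mxM x y : y \in corner_pred one ->
  left_mx (x ** y) = left_mx x *m left_mx y.
Proof.
move=> ey; apply/matrixP => i j; rewrite !mxE -rmulA.
rewrite [y ** _ in LHS]expand ?corner_predM //.
rewrite rmul_sumr coord_sum; apply: eq_bigr => l _.
by rewrite scaleMr coordZ !mxE mulrC.
Qed.

Lemma left_mx_expand x : x \in corner_pred one ->
  left_mx x = \sum_i coord i x *: left_mx (b i).
Proof.
move=> ex; apply/matrixP => i j; rewrite mxE summxE {1}[x]expand //.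
rewrite rmul_suml coord_sum; apply: eq_bigr => l _.
by rewrite scaleMl coordZ !mxE.
Qed.

Lemma left_mx0 : left_mx 0 = 0.
Proof. by apply/matrixP => i j; rewrite !mxE rmul0l coord0. Qed.

Hypothesis trace_form_unit :
  \matrix_(i, j) \tr (left_mx (b i) *m left_mx (b j)) \in unitmx.

(** The row vector of the coordinates of x is not in the kernel of the Gram
    matrix. *)
Lemma trace_left_mx_neq0 x : x \in corner_pred one -> x != 0 ->
  exists2 y, y \in corner_pred one & \tr (left_mx x *m left_mx y) != 0.
Proof.
move=> ex nz_x; pose r : 'rV_n := \row_i coord i x.
have nz_r : r != 0.
  apply: contraNneq nz_x => r0; apply/eqP/coord_inj => // i.
  by have /rowP/(_ i) := r0; rewrite !mxE.
have : r *m \matrix_(i, j) \tr (left_mx (b i) *m left_mx (b j)) != 0.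
  by apply: contraNneq nz_r => rG; rewrite -(mulmxK trace_form_unit r) rG mul0mx.
case/rV0Pn => j; rewrite mxE => nz_j.
exists (b j); first exact: b_corner.
apply: contraNneq nz_j; rewrite (left_mx_expand ex) mulmx_suml linear_sum /= => tr0.
rewrite -[X in _ == X]tr0.
by apply/eqP/eq_bigr => i _; rewrite !mxE -scalemxAl linearZ.
Qed.

Lemma corner_sub_one (x : corner e) : val x \in corner_pred one.
Proof.
have el := corner_idl (Corner e_corner); rewrite /= in el.
have er := corner_idr (Corner e_corner); rewrite /= in er.
by rewrite unfold_in -(corner_idl x) rmulA el -rmulA -(corner_idr x) -!rmulA er.
Qed.

(** If tr(L_x L_a) is nonzero then so is the trace of y x for y = e a e, since
    e x = x e = x and traces are cyclic; an operator of square zero has trace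
    zero. *)
Lemma corner_mul_sqr_neq0 (x : corner e) : x != 0 ->
  exists y : corner e, y * x * (y * x) != 0.
Proof.
move=> nz_x; have ex := corner_sub_one x.
have [|a ea nz_tr] := trace_left_mx_neq0 ex.
  by apply: contraNneq nz_x => x0; apply/eqP/val_inj.
have ey : e ** a ** e \in corner_pred e by apply/cornerP; exists a.
exists (Corner ey); apply: contraNneq nz_tr => /(congr1 val) /=.
set z := _ ** val x => zz0.
have ez : z \in corner_pred one by rewrite !corner_predM.
have <- : \tr (left_mx z) = \tr (left_mx (val x) *m left_mx a).
  rewrite /z -!rmulA (corner_idl x) left_mxM ?corner_predM // mxtrace_mulC.
  by rewrite -[in LHS]left_mxM // -rmulA (corner_idr x) left_mxM // mxtrace_mulC.
by apply/eqP/mxtrace_sqr0; rewrite -left_mxM // zz0 left_mx0.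
Qed.

(** Left ideals of the corner are stable under scalars, as c x = (c e) x. *)
Lemma corner_artinian : left_artinian (corner e).
Proof.
pose phi (x : corner e) : 'rV_n := \row_i coord i (val x).
apply: (@artinian_of_coordinates K (corner e) _ phi) => [x y|x phix0|L idL c x Lx].
- by apply/rowP => i; rewrite !mxE coordB.
- apply/val_inj/coord_inj => [|i]; first exact: corner_sub_one.
  by have /rowP/(_ i) := phix0; rewrite !mxE.
have ec : scale c e \in corner_pred e by rewrite unfold_in scaleMr scaleMl !idemP.
exists (Corner ec * x); first exact: left_idealMl.
by apply/rowP => i; rewrite !mxE /= scaleMl corner_idl coordZ.
Qed.

Lemma trace_form_corner_semisimple : semisimple_ring (corner e).
Proof. exact: artinian_semisimple corner_artinian corner_mul_sqr_neq0. Qed.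

End TraceFormCriterion.

(** * The finite corners of the subgroup algebra *)

(* Imported only here because its notation for polynomials clashes with the one
   used for the specialisation. *)
From mathcomp Require Import finmap monalg.

Section FiniteCorner.
Variables (K : fieldType) (I : choiceType) (gT : I -> finGroupType).
Variables (ell : posnat_hom K) (s : seq I).
Local Notation Lambda := (subgroup_algebra gT ell).
Local Notation T := (seq_sub s).
Local Notation hT := (fun F : T => gT (val F)).
Local Notation sub_idx := {FG : T * T & {group hT FG.1 * hT FG.2}}.
Local Notation dim := #|{: sub_idx}|.
Implicit Types (x y : Lambda) (a u v : sub_idx) (c : subgroup_index gT).

(** Index of the same basis element for the whole family of groups. *)
Definition widen_idx a : subgroup_index gT :=
  @sindex I gT (val (tag a).1) (val (tag a).2) (tagged a).

Lemma widen_idx_inj : injective widen_idx.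
Proof.
move=> [[F G] U] [[F' G'] V] eqUV.
have [/val_inj eqF /val_inj eqG] : (val F, val G) = (val F', val G').
  by apply: (congr1 tag eqUV).
subst F' G'; move/eqP: eqUV; rewrite /widen_idx /sindex /=.
pose grp (FG : I * I) := {group gT FG.1 * gT FG.2}.
by rewrite -[X in _ == X]/(@Tagged _ (val F, val G) grp V) eq_Tagged => /eqP /= ->.
Qed.

(** Typed in Lambda rather than in the underlying free module, to fix which
    multiplication is meant. *)
Definition basis_elt c : Lambda := << c >>.
Definition coef c x : K := x@_c.

Lemma coefD c x y : coef c (x + y) = coef c x + coef c y.
Proof. exact: mcoeffD. Qed.

Lemma coefB c x y : coef c (x - y) = coef c x - coef c y.
Proof. exact: mcoeffB. Qed.

Lemma coefZ c d x : coef c (d *: x) = d * coef c x.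
Proof. exact: mcoeffZ. Qed.

Lemma coef0 c : coef c (0 : Lambda) = 0.
Proof. exact: mcoeff0. Qed.

Lemma coefD_eq0 c x y : coef c x = 0 -> coef c y = 0 -> coef c (x + y) = 0.
Proof. by rewrite coefD => -> ->; rewrite addr0. Qed.

Lemma coef_sum c (J : Type) (r : seq J) (P : pred J) (f : J -> Lambda) :
  coef c (\sum_(i <- r | P i) f i) = \sum_(i <- r | P i) coef c (f i).
Proof. exact: (big_morph (coef c) (coefD c) (coef0 c)). Qed.

Lemma coef_basis c c' : coef c' (basis_elt c) = (c == c')%:R.
Proof. exact: mcoeffU. Qed.

Lemma coef_ext x y : (forall c, coef c x = coef c y) -> x = y.
Proof. by move/malgP. Qed.

Lemma basis_elt_ind (P : Lambda -> Prop) :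
    P 0 -> (forall x y, P x -> P y -> P (x + y)) ->
    (forall d x, P x -> P (d *: x)) -> (forall c, P (basis_elt c)) ->
  forall x, P x.
Proof. exact: malg_ind. Qed.

Lemma coef_mul_widen a v u :
  coef (widen_idx u) (basis_elt (widen_idx a) ** basis_elt (widen_idx v)) =
    zero_ext ell (mult_number a v u).
Proof.
have [F [G [U ->]]] := sub_idxP a; have [G' [H [V ->]]] := sub_idxP v.
have [eqG|neG] := eqVneq G G'; last first.
  rewrite mult_number_neq //.
  by rewrite [X in coef _ X](@sbasis_mul_neq _ _ _ _ _ (val G) (val G')) ?coef0.
subst G'; rewrite mult_numberE [X in coef _ X](@sbasis_mul _ _ _ _ _ (val G)) coefZ.
rewrite coef_basis -[sindex (star U V)]/(widen_idx (sindex (star U V))).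
rewrite (inj_eq widen_idx_inj) /sigma /zero_ext.
case: eqP => _; last by rewrite mulr0.
by rewrite mulr1 gtn_eqF ?meet_order_gt0.
Qed.

Definition unit_elt : Lambda :=
  \sum_(F : T) @sbasis K I gT ell (val F) (val F) (diag (gT (val F))).

Lemma unit_mull (F : T) G (U : {group gT (val F) * gT G}) :
  unit_elt ** sbasis ell U = sbasis ell U.
Proof.
rewrite rmul_suml (bigD1 F) //= big1 => [|F' neF].
  by rewrite addr0 sbasis_mul diag_star /sigma meet_order_diag_left posnat_fun1 scale1r.
by rewrite sbasis_mul_neq.
Qed.

Lemma unit_mulr F (G : T) (U : {group gT F * gT (val G)}) :
  sbasis ell U ** unit_elt = sbasis ell U.
Proof.
rewrite rmul_sumr (bigD1 G) //= big1 => [|G' neG].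
  by rewrite addr0 sbasis_mul star_diag /sigma meet_order_diag posnat_fun1 scale1r.
by rewrite sbasis_mul_neq // eq_sym.
Qed.

Lemma unit_mull_out F G (U : {group gT F * gT G}) :
  F \notin s -> unit_elt ** sbasis ell U = 0.
Proof.
move=> Fs; rewrite rmul_suml big1 // => F' _; rewrite sbasis_mul_neq //.
by apply: contraNneq Fs => <-; apply: valP.
Qed.

Lemma unit_mulr_out F G (U : {group gT F * gT G}) :
  G \notin s -> sbasis ell U ** unit_elt = 0.
Proof.
move=> Gs; rewrite rmul_sumr big1 // => G' _; rewrite sbasis_mul_neq //.
by apply: contraNneq Gs => ->; apply: valP.
Qed.

Fact unit_idem_subproof : unit_elt ** unit_elt = unit_elt.
Proof. by rewrite {2}/unit_elt rmul_sumr; apply: eq_bigr => F _; apply: unit_mull. Qed.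

Definition unit_idem := Idempotent unit_idem_subproof.

Lemma corner_widen a : basis_elt (widen_idx a) \in corner_pred unit_idem.
Proof.
rewrite unfold_in /=; have [F [G [U ->]]] := sub_idxP a.
by rewrite [X in X ** _](@unit_mull F (val G) U) [X in X == _](@unit_mulr (val F) G U).
Qed.

Lemma unit_mul_out c : (forall a, c != widen_idx a) ->
  unit_elt ** basis_elt c ** unit_elt = 0.
Proof.
case: c => [[F G] U] outU; rewrite -[basis_elt _]/(sbasis ell U).
have [Fs|Fs] := boolP (F \in s); last first.
  by rewrite [X in X ** _](unit_mull_out U Fs) rmul0l.
have [Gs|Gs] := boolP (G \in s); last first.
  by rewrite -rmulA [X in _ ** X](unit_mulr_out U Gs) rmul0r.
by have /eqP[] := outU (@sindex T hT (SeqSub Fs) (SeqSub Gs) U).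
Qed.

(** For e the unit of the finite corner, e s_c e is s_c or 0. *)
Lemma coef_corner_out x c : x \in corner_pred unit_idem ->
  (forall a, c != widen_idx a) -> coef c x = 0.
Proof.
rewrite unfold_in => /eqP <- /= outc; elim/basis_elt_ind: x => [|x y IHx IHy|d x IHx|c'].
- by rewrite rmul0r rmul0l coef0.
- by rewrite (rmul_sandwichD unit_elt); apply: (coefD_eq0 IHx IHy).
- rewrite (subgroup_algebraZr d unit_elt x) subgroup_algebraZl coefZ.
  by apply: etrans (mulr0 d); apply: (congr1 ( *%R d) IHx).
have [/existsP[a /eqP ->]|/existsPn out'] := boolP [exists a, c' == widen_idx a].
  have := corner_widen a; rewrite unfold_in => /eqP /= ->.
  by rewrite coef_basis eq_sym (negPf (outc a)).
by rewrite unit_mul_out ?coef0.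
Qed.

Lemma coef_expand x : (forall c, (forall a, c != widen_idx a) -> coef c x = 0) ->
  x = \sum_a coef (widen_idx a) x *: basis_elt (widen_idx a).
Proof.
move=> outx; apply: coef_ext => c; rewrite coef_sum.
have [/existsP[a /eqP ->]|/existsPn outc] := boolP [exists a, c == widen_idx a].
  rewrite (bigD1 a) //= big1 ?addr0 => [|v ne_va].
    by rewrite coefZ coef_basis eqxx mulr1.
  by rewrite coefZ coef_basis (inj_eq widen_idx_inj) (negPf ne_va) mulr0.
rewrite outx // big1 // => a _.
by rewrite coefZ coef_basis eq_sym (negPf (outc a)) mulr0.
Qed.

Lemma corner_of_coef x : (forall c, (forall a, c != widen_idx a) -> coef c x = 0) ->
  x \in corner_pred unit_idem.
Proof.
move=> /coef_expand ->; apply: rpred_sum => a _.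
have := corner_widen a; rewrite !unfold_in => /eqP ea.
by rewrite subgroup_algebraZr subgroup_algebraZl ea.
Qed.

Lemma corner_expand x : x \in corner_pred unit_idem ->
  x = \sum_a coef (widen_idx a) x *: basis_elt (widen_idx a).
Proof. by move=> ex; apply: coef_expand => c; apply: coef_corner_out. Qed.

Hypothesis ell_indep : alg_independent_wrt gT ell.

Lemma finite_corner_semisimple (e : Defs.idempotent Lambda) :
  idem_val e \in corner_pred unit_idem -> semisimple_ring (corner e).
Proof.
move=> e_corner.
pose b (i : 'I_dim) := basis_elt (widen_idx (enum_val i)).
pose cf (i : 'I_dim) := @coef (widen_idx (enum_val i)).
apply: (@trace_form_corner_semisimple K Lambda dim unit_idem e (fun d x => d *: x) b cf).
- exact: subgroup_algebraZl.
- exact: subgroup_algebraZr.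
- by move=> i x y; apply: coefB.
- by move=> i d x; apply: coefZ.
- by move=> i; apply: corner_widen.
- move=> x ex; rewrite [LHS]corner_expand //.
  by rewrite -(@sum_enum_val T hT).
- exact: e_corner.
rewrite (@mxtrace_mult_number T hT K _ (fun i => left_mx b cf (b i)) (zero_extM ell)) =>
  [|i s1 t]; last first.
  by rewrite mxE; apply: coef_mul_widen.
rewrite unitmxE unitfE.
apply: (det_sum_specialize ell_indep _ _ (rat_trace_form_neq0 hT)) => //.
move=> i j t p p_pr; rewrite muln_gt0 => /andP[Mi Mj].
rewrite Euclid_dvdM // => /orP[] p_dvd.
  by have [F pF] := mult_number_prime Mi p_dvd; exists (val F).
by have [F pF] := mult_number_prime Mj p_dvd; exists (val F).
Qed.

End FiniteCorner.

(** The list s collects the left and right groups of all basis elements that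
    occur in the elements of r. *)
Lemma corner_of_seq (K : fieldType) (I : choiceType)
    (gT : I -> finGroupType) (ell : posnat_hom K) (r : seq (subgroup_algebra gT ell)) :
  exists s, {subset r <= corner_pred (unit_idem gT ell s)}.
Proof.
pose supp (x : subgroup_algebra gT ell) : seq (subgroup_index gT) := msupp x.
pose cs := flatten [seq supp x | x <- r].
pose s := [seq (tag c).1 | c <- cs] ++ [seq (tag c).2 | c <- cs].
exists s => x xr; apply: corner_of_coef => c outc.
apply: mcoeff_outdom; apply/negP => cx.
have cs_c : c \in cs by apply/flattenP; exists (supp x) => //; apply: map_f.
have s1 : (tag c).1 \in s.
  by rewrite mem_cat; apply/orP; left; apply: (map_f (fun c' => (tag c').1)).
have s2 : (tag c).2 \in s.
  by rewrite mem_cat; apply/orP; right; apply: (map_f (fun c' => (tag c').2)).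
case: c => [[F G] U] in outc cx cs_c s1 s2 *.
pose gTs (F : seq_sub s) := gT (val F).
by have /eqP[] := outc (@sindex (seq_sub s) gTs (SeqSub s1) (SeqSub s2) U).
Qed.

Theorem theorem1p1 (K : fieldType) (I : choiceType) (gT : I -> finGroupType)
    (ell : posnat_hom K)
    (charK0 : [pchar K]%R =i pred0)
    (I_nonempty : inhabited I)
    (ell_indep : alg_independent_wrt gT ell) :
  locally_semisimple (subgroup_algebra gT ell).
Proof.
split=> [r|e].
  by have [s rs] := corner_of_seq r; exists (unit_idem gT ell s).
have [s es] := corner_of_seq [:: idem_val e].
by apply: (finite_corner_semisimple ell_indep (es _ _)); rewrite inE.
Qed.
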